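(* Let $n\geq 3$ and let $\Gamma=SL_n(\mathbb{Z})\ltimes\mathcal{M}_n(\mathbb{Z})$, where $SL_n(\mathbb{Z})$ acts on the additive group $\mathcal{M}_n(\mathbb{Z})$ of $n\times n$ integer matrices by left multiplication. For $\delta\in SL_n(\mathbb{Z})$, let $S_\delta:\Gamma\to\Gamma$ be defined by $S_\delta((\alpha,A))=(\alpha,A\delta)$ for all $(\alpha,A)\in\Gamma$. Then: (a) $S_\delta\in \mathrm{Aut}(\Gamma)$ for every $\delta\in SL_n(\mathbb{Z})$. (b) The map $\Phi:SL_n(\mathbb{Z})\to \mathrm{Aut}(\Gamma)$, $\Phi(\delta)=S_\delta$, is a group homomorphism. (c) For $\delta\in SL_n(\mathbb{Z})$, $S_\delta\in \mathrm{Int}(\Gamma)$ if and only if $\delta\in\{\pm I\}$, where $I$ is the $n\times n$ identity matrix. In particular, the outer automorphism group $\mathrm{Out}(\Gamma)=\mathrm{Aut}(\Gamma)/\mathrm{Int}(\Gamma)$ is infinite.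
   Context: The group $\Gamma=SL_n(\mathbb{Z})\ltimes\mathcal{M}_n(\mathbb{Z})$ is the set $SL_n(\mathbb{Z})\times\mathcal{M}_n(\mathbb{Z})$ with multiplication $(\alpha_1,A_1)(\alpha_2,A_2)=(\alpha_1\alpha_2,A_1+\alpha_1A_2)$. $\mathrm{Aut}(\Gamma)$ is the group of automorphisms of $\Gamma$ under composition (with the product of automorphisms in part (b) written so that $A\mapsto A\delta$ is right multiplication), and $\mathrm{Int}(\Gamma)$ is the normal subgroup of inner automorphisms. *)

(* Defs.v *)
From HB Require Import structures.
From mathcomp Require Import all_boot all_order all_algebra generic_quotient.
From mathcomp Require Import boolp classical_sets cardinality.

Set Implicit Arguments.
Unset Strict Implicit.
Unset Printing Implicit Defensive.

Import GRing.Theory.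

Section AutomorphismGroup.
Variable G : groupType.
Implicit Types f g : G -> G.

Definition is_automorphism f : Prop :=
  {morph f : x y / (x * y)%g} /\ bijective f.

Record Aut := MkAut { aut_fun :> G -> G; autP : is_automorphism aut_fun }.

HB.instance Definition _ := gen_eqMixin Aut.
HB.instance Definition _ := gen_choiceMixin Aut.

Lemma aut_ext (f g : Aut) : f =1 g -> f = g.
Proof.
case: f g => [f fP] [g gP] /= /funext fg; case: _ / fg in gP *.
by rewrite (Prop_irrelevance fP gP).
Qed.

Lemma is_aut_id : is_automorphism id.
Proof. by split=> //; exists id. Qed.

Lemma is_aut_comp f g :
  is_automorphism f -> is_automorphism g -> is_automorphism (g \o f).
Proof.
move=> [fM fb] [gM gb]; split; last exact: bij_comp.
by move=> x y /=; rewrite fM gM.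
Qed.

Lemma is_aut_inv f : is_automorphism f ->
  exists g, [/\ is_automorphism g, cancel f g & cancel g f].
Proof.
move=> [fM [g fK gK]]; exists g; split=> //; split; last by exists f.
by move=> x y; apply: (can_inj fK); rewrite fM !gK.
Qed.

Definition aut_one := MkAut is_aut_id.

(* As for {perm T}, products are read from left to right:
   f * g is "f, then g". *)
Definition aut_mul (f g : Aut) := MkAut (is_aut_comp (autP f) (autP g)).

Definition aut_inv (f : Aut) : Aut :=
  let: exist _ gP := cid (is_aut_inv (autP f)) in
  let: And3 g_aut _ _ := gP in MkAut g_aut.

Lemma aut_mulA : associative aut_mul.
Proof. by move=> f g h; apply: aut_ext. Qed.
Lemma aut_mul1 : left_id aut_one aut_mul.
Proof. by move=> f; apply: aut_ext. Qed.
Lemma aut_mulr1 : right_id aut_one aut_mul.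
Proof. by move=> f; apply: aut_ext. Qed.
Lemma aut_mulV : left_inverse aut_one aut_inv aut_mul.
Proof.
by move=> f; apply: aut_ext; rewrite /aut_inv; case: cid => g [? fK gK].
Qed.
Lemma aut_mulrV : right_inverse aut_one aut_inv aut_mul.
Proof.
by move=> f; apply: aut_ext; rewrite /aut_inv; case: cid => g [? fK gK].
Qed.

HB.instance Definition _ :=
  isGroup.Build Aut aut_mulA aut_mul1 aut_mulr1 aut_mulV aut_mulrV.

Lemma is_aut_conj (u : G) : is_automorphism (fun x => x ^ u)%g.
Proof.
split; first by move=> x y; rewrite conjMg.
by exists (fun x => x ^ u^-1)%g => x; rewrite ?conjgK ?conjgKV.
Qed.

(* x ^ u is u^-1 * x * u. *)
Definition inner (u : G) : Aut := MkAut (is_aut_conj u).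
Definition Int : set Aut := range inner.

Lemma innerM : {morph inner : u v / (u * v)%g}.
Proof. by move=> u v; apply: aut_ext => x /=; rewrite conjgM. Qed.

Lemma inner1 : inner 1%g = 1%g.
Proof. by apply: aut_ext => x /=; rewrite conjg1. Qed.

Lemma innerV u : inner u^-1%g = (inner u)^-1%g.
Proof. by apply: (mulgI (inner u)); rewrite -innerM !mulgV inner1. Qed.

Lemma inner_conj u (f : Aut) : (inner u ^ f)%g = inner (f u).
Proof.
apply: (mulgI f); rewrite /conjg mulVKg; apply: aut_ext => x /=.
have [fM _] := autP f.
suff fV y : f y^-1%g = (f y)^-1%g by rewrite /conjg !fM fV.
have f1 : f 1%g = 1%g by apply: (mulgI (f 1%g)); rewrite -fM !mulg1.
by apply: (mulgI (f y)); rewrite -fM !mulgV.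
Qed.

Lemma Int1 : Int 1%g. Proof. by exists 1%g; rewrite // inner1. Qed.
Lemma IntM (f g : Aut) : Int f -> Int g -> Int (f * g)%g.
Proof. by move=> [u _ <-] [v _ <-]; exists (u * v)%g; rewrite // innerM. Qed.
Lemma IntV (f : Aut) : Int f -> Int (f^-1)%g.
Proof. by move=> [u _ <-]; exists u^-1%g; rewrite // innerV. Qed.
Lemma Int_normal (f g : Aut) : Int f -> Int (f ^ g)%g.
Proof. by move=> [u _ <-]; exists (g u); rewrite // inner_conj. Qed.

(* Left and right cosets of Int agree by Int_normal. *)
Definition out_rel : rel Aut := fun f g : Aut => `[< Int (f * g^-1)%g >].

Lemma out_refl : reflexive out_rel.
Proof. by move=> f; apply/asboolP; rewrite mulgV; apply: Int1. Qed.
Lemma out_sym : symmetric out_rel.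
Proof.
suff S (f g : Aut) : out_rel f g -> out_rel g f by move=> f g; apply/idP/idP; exact: S.
by move=> /asboolP/IntV; rewrite invgM invgK => ?; apply/asboolP.
Qed.
Lemma out_trans : transitive out_rel.
Proof.
move=> g f h /asboolP fg /asboolP gh; apply/asboolP.
by have := IntM fg gh; rewrite mulgA mulgVK.
Qed.

Canonical out_equiv := EquivRel out_rel out_refl out_sym out_trans.

Local Open Scope quotient_scope.

Definition Out := {eq_quot out_equiv}.

HB.instance Definition _ := Choice.on Out.
HB.instance Definition _ := EqQuotient.on Out.

Definition out_mul (a b : Out) : Out := \pi_Out (repr a * repr b)%g.
Definition out_inv (a : Out) : Out := \pi_Out (repr a)^-1%g.
Definition out_one : Out := \pi_Out 1%g.

Lemma out_eqP (f g : Aut) : \pi_Out f = \pi_Out g <-> Int (f * g^-1)%g.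
Proof. by split=> [/eqmodP/asboolP | H]; last by apply/eqmodP/asboolP. Qed.

Lemma out_repr (f : Aut) : Int (repr (\pi_Out f) * f^-1)%g.
Proof. by apply/out_eqP; rewrite reprK. Qed.

Lemma pi_outM (f g : Aut) :
  out_mul (\pi_Out f) (\pi_Out g) = \pi_Out (f * g)%g.
Proof.
apply/out_eqP; have := Int_normal f^-1%g (out_repr g).
move/(IntM (out_repr f)).
by rewrite /conjg invgK invgM !mulgA mulgVK.
Qed.

Lemma pi_outV (f : Aut) : out_inv (\pi_Out f) = \pi_Out f^-1%g.
Proof.
apply/out_eqP; have := Int_normal f (IntV (out_repr f)).
by rewrite /conjg invgM !invgK !mulgA mulVg mul1g.
Qed.

Lemma out_mulA : associative out_mul.
Proof.
elim/quotW=> f; elim/quotW=> g; elim/quotW=> h.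
by rewrite (pi_outM g h) (pi_outM f g) (pi_outM f) (pi_outM _ h) mulgA.
Qed.
Lemma out_mul1 : left_id out_one out_mul.
Proof. by elim/quotW=> f; rewrite pi_outM mul1g. Qed.
Lemma out_mulr1 : right_id out_one out_mul.
Proof. by elim/quotW=> f; rewrite pi_outM mulg1. Qed.
Lemma out_mulV : left_inverse out_one out_inv out_mul.
Proof. by elim/quotW=> f; rewrite pi_outV pi_outM mulVg. Qed.
Lemma out_mulrV : right_inverse out_one out_inv out_mul.
Proof. by elim/quotW=> f; rewrite pi_outV pi_outM mulgV. Qed.

HB.instance Definition _ :=
  isGroup.Build Out out_mulA out_mul1 out_mulr1 out_mulV out_mulrV.

End AutomorphismGroup.

Arguments MkAut {G aut_fun}.
Arguments Int : clear implicits.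

Local Open Scope ring_scope.

Record SL (n : nat) := MkSL { slmx :> 'M[int]_n; _ : \det slmx == 1 }.

HB.instance Definition _ n := [isSub for @slmx n].
HB.instance Definition _ n := [Choice of SL n by <:].

Section SpecialLinear.
Variable n : nat.
Implicit Types a b c : SL n.

Lemma det_SL a : \det a = 1. Proof. by case: a => A /= /eqP. Qed.

Lemma SL_unit a : (a : 'M_n) \in unitmx.
Proof. by rewrite unitmxE det_SL unitr1. Qed.

Lemma sl_one_det : \det (1%:M : 'M[int]_n) == 1. Proof. by rewrite det1. Qed.
Lemma sl_mul_det a b : \det (a *m b) == 1.
Proof. by rewrite det_mulmx !det_SL mulr1. Qed.
Lemma sl_inv_det a : \det (invmx a) == 1.
Proof. by rewrite det_inv det_SL invr1. Qed.

Definition sl_one := MkSL sl_one_det.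
Definition sl_mul a b := MkSL (sl_mul_det a b).
Definition sl_inv a := MkSL (sl_inv_det a).

Lemma sl_mulA : associative sl_mul.
Proof. by move=> a b c; apply: val_inj; rewrite /= mulmxA. Qed.
Lemma sl_mul1 : left_id sl_one sl_mul.
Proof. by move=> a; apply: val_inj; rewrite /= mul1mx. Qed.
Lemma sl_mulr1 : right_id sl_one sl_mul.
Proof. by move=> a; apply: val_inj; rewrite /= mulmx1. Qed.
Lemma sl_mulV : left_inverse sl_one sl_inv sl_mul.
Proof. by move=> a; apply: val_inj; rewrite /= mulVmx ?SL_unit. Qed.
Lemma sl_mulrV : right_inverse sl_one sl_inv sl_mul.
Proof. by move=> a; apply: val_inj; rewrite /= mulmxV ?SL_unit. Qed.

HB.instance Definition _ :=
  isGroup.Build (SL n) sl_mulA sl_mul1 sl_mulr1 sl_mulV sl_mulrV.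

End SpecialLinear.

(* A separate constant, so that the group law below is the semidirect product
   and not the componentwise one on pairs. *)
Definition Gamma (n : nat) : Type := (SL n * 'M[int]_n)%type.

HB.instance Definition _ n := Choice.copy (Gamma n) (SL n * 'M[int]_n)%type.

Section SemidirectProduct.
Variable n : nat.
Implicit Types x y z : Gamma n.

Definition gamma_one : Gamma n := (1%g, 0).
Definition gamma_mul x y : Gamma n := ((x.1 * y.1)%g, x.2 + x.1 *m y.2).
Definition gamma_inv x : Gamma n := (x.1^-1%g, - (invmx x.1 *m x.2)).

Lemma gamma_mulA : associative gamma_mul.
Proof.
by move=> x y z; congr pair; rewrite /= ?mulgA // mulmxDr addrA mulmxA.
Qed.
Lemma gamma_mul1 : left_id gamma_one gamma_mul.
Proof. by move=> [a A]; congr pair; rewrite /= ?mul1g // mul1mx add0r. Qed.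
Lemma gamma_mulr1 : right_id gamma_one gamma_mul.
Proof. by move=> [a A]; congr pair; rewrite /= ?mulg1 // mulmx0 addr0. Qed.
Lemma gamma_mulV : left_inverse gamma_one gamma_inv gamma_mul.
Proof. by move=> x; congr pair; rewrite /= ?mulVg // addNr. Qed.
Lemma gamma_mulrV : right_inverse gamma_one gamma_inv gamma_mul.
Proof.
move=> x; congr pair; rewrite /= ?mulgV // mulmxN mulmxA mulmxV ?SL_unit //.
by rewrite mul1mx subrr.
Qed.

HB.instance Definition _ := isGroup.Build (Gamma n)
  gamma_mulA gamma_mul1 gamma_mulr1 gamma_mulV gamma_mulrV.

Definition Sdelta (d : SL n) (x : Gamma n) : Gamma n := (x.1, x.2 *m d).

End SemidirectProduct.

(* Main.v *)
(* If S_delta is conjugation by (beta, B), then evaluating at (1, A) gives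
   beta^-1 A = A delta for every A. With A = I this reads delta = beta^-1, so
   delta commutes with all matrices; it is therefore scalar, and a scalar
   integer matrix of determinant 1 is I or -I. Conversely S_(-I) is conjugation
   by (-I, 0). Out is infinite because the transvections I + k E_10, k in nat,
   are pairwise distinct modulo I and -I. *)
Require Import Defs.
From mathcomp Require Import all_boot all_order all_algebra.
From mathcomp Require Import boolp classical_sets cardinality.

Import GRing.Theory.
(* GRing.Theory shadows this name by the version for semirings. *)
Import monoid(monoid_morphism).

Local Open Scope ring_scope.

(** Commuting with the matrix unit E_k0 and comparing entries (i, 0) gives C_ik = [i = k] C_00. *)
Lemma central_mx_is_scalar (R : pzRingType) (n : nat) (C : 'M[R]_n) :
  (forall A : 'M[R]_n, C *m A = A *m C) -> is_scalar_mx C.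
Proof.
case: n C => [|n] C comC; first by rewrite flatmx0 mx0_is_scalar.
apply/is_scalar_mxP; exists (C 0 0); apply/matrixP=> i k; rewrite mxE.
have /matrixP/(_ i 0) := comC (delta_mx k 0).
rewrite !mxE (bigD1 k) //= [X in _ = X -> _](bigD1 0) //= !mxE !eqxx mulr1 andbT.
rewrite !big1 => [|j /negPf jN|j /negPf jN]; rewrite ?mxE ?jN ?andbF ?mulr0 ?mul0r //.
by rewrite !addr0 mulr_natl.
Qed.

(** As j < i, the matrix is lower triangular with unit diagonal. *)
Lemma det_lower_transvection (R : comPzRingType) (n : nat) (i j : 'I_n) (a : R) :
  (j < i)%N -> \det (1%:M + a *: delta_mx i j) = 1.
Proof.
move=> lt_ji; rewrite det_trig.
  apply: big1 => k _; rewrite !mxE eqxx.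
  case: eqP => [->|_]; last by rewrite mulr0 addr0.
  by rewrite -val_eqE /= gtn_eqF // mulr0 addr0.
apply/is_trig_mxP => k l lt_kl; rewrite !mxE -[k == l]val_eqE /= (ltn_eqF lt_kl) add0r.
by case: eqP lt_kl => [->|_]; case: eqP => [->|_]; rewrite ?mulr0 // ltnNge ltnW.
Qed.

Lemma intX_eq1 (c : int) (n : nat) : (0 < n)%N -> c ^+ n = 1 ->
  c = 1 \/ c = -1.
Proof.
move=> n_gt0 cn1; have : c \is a GRing.unit by rewrite -(unitrX_pos _ n_gt0) cn1.
by case/orP=> /eqP; [left | right].
Qed.

Section SdeltaAutomorphisms.
Variable n : nat.
Implicit Types d e : SL n.

Lemma SdeltaM d e x : Sdelta (d * e)%g x = Sdelta e (Sdelta d x).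
Proof. by rewrite /Sdelta /= mulmxA. Qed.

Lemma Sdelta1 x : Sdelta (1%g : SL n) x = x.
Proof. by case: x => a A; rewrite /Sdelta /= mulmx1. Qed.

Lemma is_aut_Sdelta d : is_automorphism (@Sdelta n d).
Proof.
split=> [[a A] [b B] |]; first by congr pair; rewrite /= mulmxDl mulmxA.
exists (@Sdelta n d^-1%g) => x; rewrite -SdeltaM ?mulgV ?mulVg; exact: Sdelta1.
Qed.

Definition Sdelta_aut d : Aut (Gamma n) := MkAut (is_aut_Sdelta d).

(** Products in [Aut] are read from left to right, as are successive right multiplications, so the
    order of factors is preserved. *)
Lemma Sdelta_aut_monoid_morphism : monoid_morphism Sdelta_aut.
Proof.
split=> [|d e]; apply: aut_ext => x /=; [exact: Sdelta1 | exact: SdeltaM].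
Qed.

Lemma Sdelta_autVM d e :
  (Sdelta_aut d * (Sdelta_aut e)^-1)%g = Sdelta_aut (d * e^-1)%g.
Proof.
apply: (mulIg (Sdelta_aut e)).
by rewrite mulgVK -(Sdelta_aut_monoid_morphism.2) mulgVK.
Qed.

Lemma Sdelta_intP d : (0 < n)%N ->
  Int (Gamma n) (Sdelta_aut d) <->
  (d = 1%:M :> 'M[int]_n \/ d = - 1%:M :> 'M[int]_n).
Proof.
move=> n_gt0; split=> [[[b B] _ /(congr1 (@aut_fun _))/= bd] | ].
  (* Conjugating (1, A) by (b, B) has second component -b^-1 B + b^-1 (A + B), where B cancels. *)
  have conjA (A : 'M_n) : invmx b *m A = A *m d.
    have /(congr1 snd) := congr1 (fun f => f (1%g, A)) bd.
    by rewrite /= mul1mx mulmxDr addrC addrK.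
  have /is_scalar_mxP[c dE] : is_scalar_mx d.
    by apply: central_mx_is_scalar => A; rewrite -conjA -[in LHS](mul1mx d) -conjA mulmx1.
  have := det_SL d; rewrite dE det_scalar => /(intX_eq1 _ _ n_gt0)[->|->].
    by left.
  by right; rewrite raddfN.
case=> dE.
  exists 1%g => //; rewrite inner1; apply: aut_ext => -[a A].
  by rewrite /= /Sdelta /= dE mulmx1.
exists (d, 0) => //; apply: aut_ext => -[a A] /=.
(* Left multiplication by u = (d, 0) clears the inverse: it remains to compare x u with u S_d(x). *)
apply: (@mulgI (Gamma n) (d, 0)); rewrite /conjg mulVKg.
congr pair; rewrite /= ?add0r; last by rewrite mulmx0 addr0 dE mulmxN mulNmx mulmx1 mul1mx opprK.
by apply: val_inj; rewrite /= dE mulmxN mulNmx mulmx1 mul1mx.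
Qed.

End SdeltaAutomorphisms.

Lemma infinite_Out_Gamma (n : nat) : (2 <= n)%N ->
  infinite_set [set: Out (Gamma n)].
Proof.
case: n => [|[|n]] // _.
(* [lift 0 0] is the index 1, available in size at least 2. *)
have detT (k : nat) : \det (1%:M + k%:Z *: delta_mx (lift 0 0) 0 : 'M[int]_n.+2) == 1.
  by rewrite det_lower_transvection //.
pose f k : Out (Gamma n.+2) := \pi_(Out (Gamma n.+2))%qT (Sdelta_aut _ (MkSL (detT k))).
have f_inj : injective f.
  move=> k l /out_eqP; rewrite Sdelta_autVM => /Sdelta_intP-/(_ isT).
  set t := MkSL (detT k); set u := MkSL (detT l).
  (* Turns t u^-1 = I or -I into t = u or t = -u. *)
  have tuE : (t : 'M_n.+2) = (t * u^-1)%g *m u by rewrite -[RHS]/(slmx (t * u^-1 * u)%g) mulgVK.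
  case=> tu1; move: tuE; rewrite tu1 ?mulNmx mul1mx => /matrixP.
    (* If t = u, entry (1, 0) reads k = l. *)
    move=> /(_ (lift 0 0) 0); rewrite !mxE.
    by rewrite !eqxx !mulr1 => /addrI [].
  (* If t = -u, entry (0, 0) reads 1 = -1. *)
  move=> /(_ 0 0); rewrite !mxE.
  by rewrite !mulr0.
(* Were [Out] finite, its preimage under the injective [f], which is all of [nat], would be
   finite. *)
move=> /(finite_preimage (in2W f_inj)); rewrite preimage_setT; exact: infinite_nat.
Qed.

Theorem proposition11 (n : nat) (hn : (3 <= n)%N) :
  exists S_aut : forall d : SL n, is_automorphism (@Sdelta n d),
    let Phi : SL n -> Aut (Gamma n) := fun d => MkAut (S_aut d) in
    [/\ monoid_morphism Phi,
        forall d : SL n,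
          Int (Gamma n) (Phi d) <->
          (d = 1%:M :> 'M[int]_n \/ d = - 1%:M :> 'M[int]_n)
      & infinite_set [set: Out (Gamma n)]].
Proof.
exists (@is_aut_Sdelta n); split.
- exact: Sdelta_aut_monoid_morphism.
- by move=> d; apply: Sdelta_intP; apply: leq_trans hn.
- by apply: infinite_Out_Gamma; apply: ltnW.
Qed.
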